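(* Let $G$ be a virtually cyclic group generated by a finite symmetric set $X$. Then either the geodesic growth function $\Gamma_{G,X}$ is bounded above and below by exponential functions (there exist constants $1<b\le B$ with $b^n\le\Gamma_{G,X}(n)\le B^n$ for all $n$), or $\Gamma_{G,X}$ is bounded above and below by polynomials of the same degree.
   Context: Generating sets may contain repeated elements: formally a finite symmetric generating set is a finite symmetric alphabet $X$ with an epimorphism from the free monoid on $X$ onto $G$ (symmetric: each letter has a letter mapping to its inverse). A word over $X$ is a geodesic if its length equals the word length of the element it represents. The geodesic growth function $\Gamma_{G,X}(n)$ is the number of geodesic words over $X$ of length at most $n$. *)

(* Defs.v *)
From mathcomp Require Import all_boot.
From mathcomp Require Import boolp.
From Stdlib Require Import Reals.

Set Implicit Arguments.
Unset Strict Implicit.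
Unset Printing Implicit Defensive.

Definition is_group (G : Type) (mul : G -> G -> G) (one : G) (inv : G -> G)
  : Prop :=
  (forall x y z, mul x (mul y z) = mul (mul x y) z) /\
  (forall x, mul one x = x) /\ (forall x, mul x one = x) /\
  (forall x, mul (inv x) x = one) /\ (forall x, mul x (inv x) = one).

Definition npow (G : Type) (mul : G -> G -> G) (one : G) (h : G) (k : nat) : G :=
  iter k (mul h) one.

(* G is virtually cyclic: the cyclic subgroup <h> = {h^k, (h^-1)^k} has
   finite index, i.e. G is covered by finitely many left cosets t<h>. *)
Definition virtually_cyclic (G : Type) (mul : G -> G -> G) (one : G)
  (inv : G -> G) : Prop :=
  exists (h : G) (s : seq G), forall g : G,
    exists t, List.In t s /\ exists k : nat,
      g = mul t (npow mul one h k) \/ g = mul t (npow mul one (inv h) k).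

Definition evalw (G : Type) (mul : G -> G -> G) (one : G) (X : Type)
  (lab : X -> G) (w : seq X) : G :=
  foldr (fun x acc => mul (lab x) acc) one w.

Definition sym_gen_set (G : Type) (mul : G -> G -> G) (one : G)
  (inv : G -> G) (X : finType) (lab : X -> G) : Prop :=
  (forall x : X, exists y : X, lab y = inv (lab x)) /\
  (forall g : G, exists w : seq X, evalw mul one lab w = g).

Definition geodesic (G : Type) (mul : G -> G -> G) (one : G) (X : Type)
  (lab : X -> G) (w : seq X) : Prop :=
  forall w' : seq X, evalw mul one lab w' = evalw mul one lab w ->
    size w <= size w'.

Definition geod_growth (G : Type) (mul : G -> G -> G) (one : G) (X : finType)
  (lab : X -> G) (n : nat) : nat :=
  \sum_(k < n.+1)
     #|[set t : k.-tuple X | `[< geodesic mul one lab (tval t) >]]|.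

(* Main.v *)
(** In a virtually cyclic group every element lies at bounded distance from a
    power of a fixed h. If h has infinite order, a path from 1 to h^(a+b) passes
    near h^a, so |h^a| + |h^b| <= |h^(a+b)| + C for a, b >= 0. Hence geodesics
    from 1 with adjacent endpoints stay uniformly close, and Cannon's argument
    shows that the cone type of g is determined by the set of x in a fixed ball
    with |gx| < |g|. Geodesics are therefore counted by walks in a finite
    multigraph whose vertices are these sets. If some reachable vertex has two
    edges from which one can return to it, the number of walks doubles
    periodically. Otherwise each strongly connected component is a vertex or a
    cycle, and passing through a cycle raises the degree of the growth of its
    most productive exit by one. *)

Require Import Defs.
From mathcomp Require Import all_boot.
From mathcomp Require Import boolp zify.
From Stdlib Require Import Reals ZArith Lra.
(* Reals hides the MathComp notations on nat; a second import restores them. *)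
From mathcomp Require Import ssrnat.

Set Implicit Arguments.
Unset Strict Implicit.
Unset Printing Implicit Defensive.

Lemma leq_exp2r_homo m n e : m <= n -> m ^ e <= n ^ e.
Proof. by case: e => [|e] mn; rewrite ?expn0 ?leq_exp2r. Qed.

(** * Growth of walk counts in a finite multigraph *)

Section WalkGrowth.

Variables (T : finType) (A : T -> T -> nat) (P : T -> nat -> nat).
(* P t n is the number of walks of length at most n from t in the multigraph
   with adjacency matrix A. *)
Hypothesis P0 : forall t, P t 0 = 1.
Hypothesis PS : forall t n, P t n.+1 = 1 + \sum_u A t u * P u n.

Let edge : rel T := fun t u => 0 < A t u.

(** The number of edges from [t], with multiplicity, that stay in the strongly connected component
    of [t]. *)
Definition returns (t : T) : nat := \sum_(u | connect edge u t) A t u.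

(** One natural number serves both bounds, so the lower bound needs no division; [n = 0] forces [c]
    to be positive. *)
Definition poly_growth (d : nat) (f : nat -> nat) : Prop :=
  exists c, forall n, n.+1 ^ d <= c * f n /\ f n <= c * n.+1 ^ d.

Lemma walks_leS t n : P t n <= P t n.+1.
Proof.
elim: n t => [|n IH] t; first by rewrite P0 PS.
by rewrite !PS leq_add2l; apply: leq_sum => u _; rewrite leq_mul2l IH orbT.
Qed.

Lemma walks_homo t m n : m <= n -> P t m <= P t n.
Proof.
elim: n => [|n IH]; first by rewrite leqn0 => /eqP->.
by rewrite leq_eqVlt => /predU1P[->//|/IH /leq_trans]; apply; apply: walks_leS.
Qed.

Lemma walks_gt0 t n : 0 < P t n.
Proof. by rewrite -(P0 t); apply: walks_homo. Qed.

Lemma walks_edge t u n : edge t u -> P u n < P t n.+1.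
Proof.
move=> tu; rewrite PS add1n ltnS (bigD1 u) //=.
by apply: leq_trans (leq_addr _ _); rewrite leq_pmull.
Qed.

Lemma walks_edge2 t u v n :
  edge t u -> edge t v -> u != v -> P u n + P v n <= P t n.+1.
Proof.
move=> tu tv uv; rewrite PS (bigD1 u) //= (bigD1 v) /=; last by rewrite eq_sym.
have := leq_pmull (P u n) tu; have := leq_pmull (P v n) tv; lia.
Qed.

(** A path without repeated vertices has fewer than [#|T|] edges and can be put in front of every
    walk from [u]. *)
Lemma walks_connect t u n : connect edge t u -> P u n <= P t (n + #|T|).
Proof.
case/connectP => p0 /shortenP[p pp up _] -> {p0}.
have /leq_trans: P (last t p) n <= P t (n + size p).
  elim: p t pp {up} => [|v p IH] t /=; first by rewrite addn0.
  case/andP => tv /IH h; rewrite addnS.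
  by apply: leq_trans h (ltnW (walks_edge _ tv)).
apply; apply: walks_homo; rewrite leq_add2l.
by have := max_card (mem (t :: p)); rewrite (card_uniqP up) => /ltnW.
Qed.

(** After each returning edge a path leads back to [t], where any walk from [t] can be resumed. *)
Lemma walks_double t n :
  1 < returns t -> 2 * P t n <= P t (n + #|T|).+1.
Proof.
move=> rt; rewrite PS.
have : returns t * P t n <= \sum_u A t u * P u (n + #|T|).
  rewrite /returns big_distrl /=.
  rewrite [X in _ <= X](bigID [pred u | connect edge u t]) /=.
  apply: leq_trans (leq_addr _ _); apply: leq_sum => u ut.
  by rewrite leq_mul2l walks_connect ?orbT.
have := leq_mul rt (leqnn (P t n)); lia.
Qed.

(** The bound is put on a power of [P s n] to avoid real roots. Doubling takes [L] steps, but blocks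
    of [2 * L] are used, which leaves room for the path from [s] to [t]. The exponent 2 absorbs the
    rounding of [n %/ (2 * L)], since [P s n] is at least 2 for positive [n]. *)
Lemma walks_exp s t : connect edge s t -> 1 < returns t ->
  exists2 q, 0 < q & forall n, 2 ^ n <= P s n ^ (q * 2).
Proof.
move=> st rt; set L := #|T|.+1.
have dbl m : 2 ^ m <= P t (m * L).
  elim: m => [|m IH]; first by rewrite P0.
  rewrite expnS (mulSn m) addnC /L addnS.
  apply: leq_trans (walks_double _ rt).
  by rewrite leq_mul2l IH.
have s2 : 2 <= P s 1.
  have [u tu] : exists u, edge t u.
    apply/existsP; move: rt; apply: contraTT; rewrite negb_exists => /forallP nt.
    rewrite /returns big1 // => u _; apply/eqP; move: (nt u).
    by rewrite /edge -eqn0Ngt.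
  case/connectP: st => [[|v p]] /=.
    by move=> _ tE; rewrite -tE in tu *; have := walks_edge 0 tu; rewrite P0.
  by case/andP => sv _ _; have := walks_edge 0 sv; rewrite P0.
have low n : 2 ^ (n %/ (2 * L)) <= P s n.
  set m := n %/ (2 * L); have [m0|m_gt0] := posnP m.
    by rewrite m0 walks_gt0.
  apply: leq_trans (dbl m) _; apply: leq_trans (walks_connect _ st) _.
  apply: walks_homo; have := leq_trunc_div n (2 * L); rewrite -/m.
  have : L <= m * L by rewrite leq_pmull.
  rewrite /L; nia.
exists (2 * L) => [//|n]; have [->|n_gt0] := posnP n.
  by rewrite expn_gt0 walks_gt0.
rewrite mulnC expnM.
have h : 2 ^ (n %/ (2 * L)).+1 <= P s n ^ 2.
  rewrite expnS -mulnn leq_mul //.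
  by apply: leq_trans s2 _; apply: walks_homo.
apply: leq_trans (_ : (2 ^ (n %/ (2 * L)).+1) ^ (2 * L) <= _).
  by rewrite -expnM leq_exp2l // ltnW // ltn_ceil.
by rewrite leq_exp2r.
Qed.

(** [D] is the largest degree in [U]; the alternative [D = 0] covers the empty list, where no vertex
    attains it. *)
Lemma poly_growth_fin (U : seq T) :
  (forall u, u \in U -> exists d, poly_growth d (P u)) ->
  exists D c, (forall u n, u \in U -> P u n <= c * n.+1 ^ D) /\
    (D = 0 \/ exists2 v, v \in U & forall n, n.+1 ^ D <= c * P v n).
Proof.
elim: U => [_|t U IH tU]; first by exists 0, 0; split => //; left.
have [|D [c [up lo]]] := IH.
  by move=> u uU; apply: tU; rewrite inE uU orbT.
have [|d [k kP]] := tU t; first by rewrite inE eqxx.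
have mono a b n e e' : a <= b -> e <= e' -> a * n.+1 ^ e <= b * n.+1 ^ e'.
  by move=> ab ee; apply: leq_mul => //; rewrite leq_pexp2l.
case: (leqP d D) => dD.
  exists D, (c + k); split.
    move=> u n; rewrite inE => /predU1P[->|uU].
      by apply: leq_trans (kP n).2 _; apply: mono; rewrite ?leq_addl.
    by apply: leq_trans (up u n uU) _; apply: mono; rewrite ?leq_addr.
  case: lo => [->|[v vU lo]]; [by left | right; exists v].
    by rewrite inE vU orbT.
  by move=> n; apply: leq_trans (lo n) _; rewrite leq_mul2r leq_addr orbT.
exists d, (c + k); split.
  move=> u n; rewrite inE => /predU1P[->|uU].
    by apply: leq_trans (kP n).2 _; apply: mono; rewrite ?leq_addl.
  by apply: leq_trans (up u n uU) _; apply: mono; rewrite ?leq_addr // ltnW.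
right; exists t; first by rewrite inE eqxx.
by move=> n; apply: leq_trans (kP n).1 _; rewrite leq_mul2r leq_addl orbT.
Qed.

(** Starting at some [m] of at least half of [n], about [n / (2 * L)] applications of the recurrence
    each add at least [g m], which gains one factor [n]. The first summand of the constant handles
    [n < 2 * L]. *)
Lemma recurrence_lower (f g : nat -> nat) D c L :
  0 < L -> (forall n, 0 < f n) -> {homo g : m n / m <= n} ->
  (forall n, f n + g n <= f (n + L)) ->
  (forall n, n.+1 ^ D <= c * g n) ->
  exists c', forall n, n.+1 ^ D.+1 <= c' * f n.
Proof.
move=> L_gt0 f_gt0 g_homo fg gD.
have iter_fg k m : k * g m <= f (m + k * L).
  elim: k => [//|k IH]; have := fg (m + k * L).
  have := g_homo m (m + k * L) (leq_addr _ _).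
  rewrite !mulSn (addnC L) addnA; lia.
exists ((2 * L) ^ D.+1 + 2 ^ D * c * (4 * L)) => n.
rewrite mulnDl; set k := n %/ (2 * L).
have [n_lt|n_ge] := ltnP n (2 * L).
  apply: leq_trans (leq_addr _ _); apply: leq_trans (leq_pmulr _ (f_gt0 n)).
  by rewrite leq_exp2r.
apply: leq_trans (leq_addl _ _).
have k_gt0 : 0 < k by rewrite divn_gt0 // muln_gt0.
have n_ceil : n < k.+1 * (2 * L) by apply: ltn_ceil; rewrite muln_gt0.
have n_floor : k * (2 * L) <= n := leq_trunc_div _ _.
set m := n - k * L.
have mE : m + k * L = n by rewrite subnK //; nia.
have h1 : n.+1 <= 2 * m.+1 by lia.
have h2 : n.+1 <= 4 * L * k by nia.
have := iter_fg k m; rewrite mE => h3.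
rewrite expnSr.
have h4 : n.+1 ^ D <= 2 ^ D * (c * g m).
  apply: leq_trans (_ : (2 * m.+1) ^ D <= _); first by rewrite leq_exp2r_homo.
  by rewrite expnMn leq_mul2l gD orbT.
apply: leq_trans (leq_mul h4 h2) _.
rewrite -!mulnA !leq_mul2l; apply/orP; right; apply/orP; right.
by rewrite mulnCA leq_mul2l mulnCA leq_mul2l mulnC h3 !orbT.
Qed.

Lemma walks_poly s : (forall t, connect edge s t -> returns t <= 1) ->
  exists d, poly_growth d (P s).
Proof.
have [m] := ubnP #|connect edge s|; elim: m s => // m IH s sm ret_le1.
(* A vertex that cannot return to [s] reaches strictly fewer vertices, so the induction on their
   number applies. *)
have IHs u : connect edge s u -> ~~ connect edge u s ->
    exists d, poly_growth d (P u).
  move=> su us; apply: IH => [|t ut].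
    rewrite -ltnS; apply: leq_trans sm; rewrite ltnS; apply: proper_card.
    apply/properP; split; last by exists s; [exact: connect0 | exact: us].
    by apply/subsetP => t; apply: connect_trans.
  by apply: ret_le1; apply: connect_trans ut.
pose a := \sum_t \sum_u A t u.
have sumA_le t (p : pred T) : \sum_(u | p u) A t u <= a.
  rewrite /a [X in _ <= X](bigD1 t) //=.
  apply: leq_trans (leq_addr _ _).
  by rewrite [X in _ <= X](bigID p) leq_addr.
have sum_le t (p : pred T) n b : (forall u, p u -> edge t u -> P u n <= b) ->
    \sum_(u | p u) A t u * P u n <= (\sum_(u | p u) A t u) * b.
  move=> le_b; rewrite big_distrl; apply: leq_sum => u pu.
  have [->//|tu] := posnP (A t u).
  by rewrite leq_mul2l le_b ?orbT.
case: (boolP [exists u, edge s u && connect edge u s]); last first.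
  (* Here [s] lies on no cycle, and its degree is the largest one among its successors. *)
  rewrite negb_exists => /forallP noret.
  have [|D [c [up lo]]] := @poly_growth_fin [seq u <- enum T | edge s u].
    move=> u; rewrite mem_filter => /andP[su _]; apply: IHs (connect1 su) _.
    by have := noret u; rewrite su.
  (* The factor [2 ^ D] pays for the shift from [n.+1] to [n.+2] in the lower bound. *)
  exists D, (1 + a * c + 2 ^ D * (1 + c)) => -[|n].
    rewrite P0 exp1n; split; lia.
  split.
    apply: leq_trans (_ : 2 ^ D * (1 + c) * P s n.+1 <= _); last first.
      by rewrite leq_mul2r leq_addl orbT.
    case: lo => [->|[v]].
      by rewrite !expn0 mul1n muln_gt0 walks_gt0.
    rewrite mem_filter => /andP[sv _] lo.
    apply: leq_trans (_ : (2 * n.+1) ^ D <= _).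
      by apply: leq_exp2r_homo; lia.
    rewrite expnMn -mulnA leq_mul2l; apply/orP; right.
    apply: leq_trans (lo n) _; apply: leq_mul; first by rewrite leq_addl.
    by rewrite ltnW // walks_edge.
  rewrite PS; apply: leq_trans (_ : (1 + a * c) * n.+1 ^ D <= _); last first.
    by apply: leq_mul; [rewrite leq_addr | apply: leq_exp2r_homo].
  rewrite mulnDl leq_add ?expn_gt0 //; first by rewrite mul1n expn_gt0.
  apply: leq_trans (_ : (\sum_u A s u) * (c * n.+1 ^ D) <= _).
    by apply: sum_le => u _ su; apply: up; rewrite mem_filter su mem_enum.
  by rewrite mulnA leq_mul2r leq_mul2r sumA_le !orbT.
case/existsP => s1 /andP[ss1 s1s].
(* Now [s] lies on a cycle, and [C] is its strongly connected component. *)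
pose C := [pred t | connect edge s t && connect edge t s].
have ret t : t \in C -> exists2 t1, edge t t1 & t1 \in C.
  case/andP => st ts; have /connectP[p pp tE] : connect edge s t := st.
  case/connectP: (ts) => [[|t1 q]] /=.
    move=> _ tE'; rewrite -tE'; exists s1 => //.
    by rewrite inE s1s connect1.
  case/andP => tt1 qp sE; exists t1 => //; rewrite inE.
  rewrite (connect_trans st (connect1 tt1)) /=.
  by apply/connectP; exists q.
pose exits := [seq u <- enum T | (u \notin C) && [exists t in C, edge t u]].
have exitsP u : u \in exits -> u \notin C /\ exists2 t, t \in C & edge t u.
  rewrite mem_filter => /andP[/andP[uC /existsP[t /andP[tC tu]]] _].
  by split=> //; exists t.
have [|D [c [up lo]]] := @poly_growth_fin exits.
  move=> u /exitsP[uC [t tC tu]].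
  have su : connect edge s u.
    by case/andP: tC => st _; apply: connect_trans st (connect1 tu).
  by apply: IHs => //; move: uC; rewrite inE su.
(* At most [#|T|] steps lead from [s] to the vertex before an exit, one edge follows, and at most
   [#|T|] steps lead back to [s]. *)
pose L := (#|T| + #|T|).+1.
have low : exists c', forall n, n.+1 ^ D.+1 <= c' * P s n.
  have exit_low t0 v n : t0 \in C -> edge t0 v -> v \notin C ->
      P s n + P v n <= P s (n + L).
    move=> t0C t0v vC; have [t1 t01 t1C] := ret _ t0C.
    have v1 : v != t1 by apply: contraNneq vC => ->.
    have /andP[st0 _] := t0C; have /andP[_ t1s] := t1C.
    rewrite /L addnS addnA -addSn.
    apply: leq_trans (walks_connect _ st0).
    apply: leq_trans (walks_edge2 _ t0v t01 v1).
    by rewrite addnC leq_add ?walks_homo ?leq_addr // walks_connect.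
  (* For [D = 0] exits may be missing, but each turn around the cycle already adds one walk, so the
     constant 1 replaces the exit. *)
  case: lo => [D0|[v /exitsP[vC [t0 t0C t0v]] vlo]].
    apply: (@recurrence_lower (P s) (fun=> 1) D 1 L) => // [n|n|n].
    - exact: walks_gt0.
    - rewrite addn1; apply: leq_trans (walks_homo _ (_ : (n + #|T|).+1 <= _)).
        exact: leq_ltn_trans (walks_connect _ s1s) (walks_edge _ ss1).
      by rewrite /L; lia.
    - by rewrite D0.
  apply: (@recurrence_lower (P s) (P v) D c L) => // [n|m' n|n].
  - exact: walks_gt0.
  - exact: walks_homo.
  - exact: exit_low t0C t0v vC.
have [c' c'P] := low.
(* [B * n.+1 ^ D] bounds what one step adds: the empty walk and the walks leaving [C]. *)
pose B := 1 + a * c.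
have upC n t : t \in C -> P t n <= B * n.+1 ^ D.+1.
  elim: n t => [|n IHn] t tC; first by rewrite P0 exp1n /B; lia.
  rewrite PS (bigID C) /=.
  (* At most one edge from [t] stays in [C], so the coefficient [B] does not grow. *)
  have in_le : \sum_(u | C u) A t u * P u n <= B * n.+1 ^ D.+1.
    apply: leq_trans (_ : (\sum_(u | C u) A t u) * (B * n.+1 ^ D.+1) <= _).
      by apply: sum_le => u uC _; apply: IHn.
    rewrite -[X in _ <= X]mul1n leq_mul2r; apply/orP; right.
    have /andP[st ts] := tC.
    apply: leq_trans (ret_le1 t st); rewrite /returns.
    rewrite [X in _ <= X](bigID C) /=; apply: leq_trans (leq_addr _ _).
    rewrite [X in X <= _](eq_bigl (fun u => connect edge u t && C u)) //.
    move=> u /=; case sut: (connect edge u t) => //=.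
    apply/negP => /andP[_ us]; move/negP: sut; apply.
    exact: connect_trans us st.
  have out_le : \sum_(u | ~~ C u) A t u * P u n <= a * c * n.+1 ^ D.
    apply: leq_trans (_ : (\sum_(u | ~~ C u) A t u) * (c * n.+1 ^ D) <= _).
      apply: sum_le => u uC tu; apply: up; rewrite mem_filter mem_enum uC /= andbT.
      by apply/existsP; exists t; rewrite tC.
    by rewrite mulnA leq_mul2r leq_mul2r sumA_le !orbT.
  have n_gt0 : 0 < n.+1 ^ D by rewrite expn_gt0.
  have le_xy : n.+1 ^ D <= n.+2 ^ D by apply: leq_exp2r_homo.
  move: n_gt0 in_le out_le le_xy; rewrite (expnSr n.+1) (expnSr n.+2).
  move: (n.+1 ^ D) (n.+2 ^ D) => x y x_gt0 in_le out_le le_xy.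
  have : B * x * n.+2 <= B * y * n.+2 by rewrite leq_mul2r leq_mul2l le_xy !orbT.
  have : B * x = x + a * c * x by rewrite /B mulnDl mul1n.
  move: in_le out_le; rewrite !mulnA (mulnS _ n.+1) /=; lia.
exists D.+1, (B + c') => n; split.
  by apply: leq_trans (c'P n) _; rewrite leq_mul2r leq_addl orbT.
apply: leq_trans (upC n s _) _; first by rewrite inE connect0.
by rewrite leq_mul2r leq_addr orbT.
Qed.

Theorem walks_dichotomy s :
  (exists2 q, 0 < q & forall n, 2 ^ n <= P s n ^ (q * 2)) \/
  exists d, poly_growth d (P s).
Proof.
have [|no_exp] := boolP [exists t, connect edge s t && (1 < returns t)].
  by case/existsP => t /andP[st rt]; left; apply: walks_exp st rt.
right; apply: walks_poly => t st; rewrite leqNgt; apply/negP => rt.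
by case/existsP: no_exp; exists t; rewrite st.
Qed.

End WalkGrowth.

(** * Word length and the word metric *)

Section VirtuallyCyclic.

Variables (G : Type) (mul : G -> G -> G) (one : G) (inv : G -> G).
Variables (X : finType) (lab : X -> G).
Hypothesis grp : is_group mul one inv.
Hypothesis gen : sym_gen_set mul one inv lab.

Local Notation "x ** y" := (mul x y) (at level 40, left associativity).
Local Notation ev := (evalw mul one lab).

Let mulA x y z : x ** (y ** z) = x ** y ** z. Proof. by case: grp. Qed.
Let mul1 x : one ** x = x. Proof. by case: grp => _ []. Qed.
Let mulx1 x : x ** one = x. Proof. by case: grp => _ [_ []]. Qed.
Let mulVx x : inv x ** x = one. Proof. by case: grp => _ [_ [_ []]]. Qed.
Let mulxV x : x ** inv x = one. Proof. by case: grp => _ [_ [_ []]]. Qed.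
Let mulK x y : x ** y ** inv y = x. Proof. by rewrite -mulA mulxV mulx1. Qed.

Lemma mul_inj x y z : x ** y = x ** z -> y = z.
Proof. by move=> e; rewrite -(mul1 y) -(mulVx x) -mulA e mulA mulVx mul1. Qed.

Lemma inv_unique x y : x ** y = one -> y = inv x.
Proof. by move=> e; apply: (@mul_inj x); rewrite e mulxV. Qed.

Lemma inv_inv x : inv (inv x) = x.
Proof. by symmetry; apply: inv_unique; rewrite mulVx. Qed.

Lemma inv_mul x y : inv (x ** y) = inv y ** inv x.
Proof. by symmetry; apply: inv_unique; rewrite mulA mulK mulxV. Qed.

Lemma inv_one : inv one = one.
Proof. by symmetry; apply: inv_unique; rewrite mul1. Qed.

Lemma evalw_cat u v : ev (u ++ v) = ev u ** ev v.
Proof. by elim: u => [|x u IH] /=; rewrite ?mul1 // IH mulA. Qed.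

Lemma evalw1 x : ev [:: x] = lab x.
Proof. by rewrite /= mulx1. Qed.

Lemma ex_word_size g : exists n, `[< exists w, ev w = g /\ size w = n >].
Proof. by have [w wg] := gen.2 g; exists (size w); apply/asboolP; exists w. Qed.

Definition len g := ex_minn (ex_word_size g).

Lemma len_word g : exists2 w, ev w = g & size w = len g.
Proof. by rewrite /len; case: ex_minnP => m /asboolP[w [wg wm]] _; exists w. Qed.

Lemma len_evalw w : len (ev w) <= size w.
Proof.
by rewrite /len; case: ex_minnP => m _; apply; apply/asboolP; exists w.
Qed.

Lemma len_mul x y : len (x ** y) <= len x + len y.
Proof.
have [u <- <-] := len_word x; have [v <- <-] := len_word y.
by rewrite -evalw_cat -size_cat len_evalw.
Qed.

Lemma len_one : len one = 0.
Proof. by apply/eqP; rewrite -leqn0; apply: (len_evalw [::]). Qed.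

Lemma len_eq0 g : len g = 0 -> g = one.
Proof.
by move=> g0; have [w wg] := len_word g; rewrite g0 -wg => /size0nil ->.
Qed.

Lemma len_lab x : len (lab x) <= 1.
Proof. by rewrite -evalw1 len_evalw. Qed.

Lemma len_inv_le g : len (inv g) <= len g.
Proof.
have [w <- <-] := len_word g; elim: w => [|x w IH] /=.
  by rewrite inv_one len_one.
have [y yx] := gen.1 x; rewrite inv_mul -yx.
have := len_mul (inv (ev w)) (lab y); have := len_lab y; lia.
Qed.

Lemma len_inv g : len (inv g) = len g.
Proof.
by apply/eqP; rewrite eqn_leq len_inv_le -{1}(inv_inv g) len_inv_le.
Qed.

(** The distance of [a] and [b] in the left-invariant word metric is [len (inv a ** b)]. *)
Lemma len_tri a b p : len (inv a ** p) <= len (inv a ** b) + len (inv b ** p).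
Proof. by apply: leq_trans (len_mul _ _); rewrite mulA mulK. Qed.

Lemma len_dist_sym a b : len (inv a ** b) = len (inv b ** a).
Proof. by rewrite -len_inv inv_mul inv_inv. Qed.

(** * Powers of [h] and fellow travelling of geodesics *)

Section Powers.

Variable h : G.

(** Integer exponents merge the two families of powers in [virtually_cyclic], so that positions
    along the cyclic subgroup can be compared. *)
Definition zpow (z : Z) : G :=
  if (0 <=? z)%Z then npow mul one h (Z.to_nat z)
  else npow mul one (inv h) (Z.to_nat (- z)).

Lemma zpow0 : zpow 0 = one. Proof. by []. Qed.

Lemma zpow_succ z : zpow (Z.succ z) = h ** zpow z.
Proof.
rewrite /zpow; case: (Z.leb_spec 0 z) => z0.
  rewrite (_ : (0 <=? Z.succ z)%Z = true); last by lia.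
  by rewrite (_ : Z.to_nat (Z.succ z) = (Z.to_nat z).+1); last by lia.
case: (Z.leb_spec 0 (Z.succ z)) => z1.
  rewrite (_ : z = (-1)%Z) /=; last by lia.
  by rewrite mulA mulxV mul1.
rewrite (_ : Z.to_nat (- z) = (Z.to_nat (- Z.succ z)).+1); last by lia.
by rewrite /npow /= mulA mulxV mul1.
Qed.

Lemma zpow_add a b : zpow (a + b) = zpow a ** zpow b.
Proof.
elim/Z.peano_ind: a => [|a IH|a IH].
- by rewrite zpow0 mul1.
- by rewrite Z.add_succ_l !zpow_succ IH mulA.
- apply: (@mul_inj h); rewrite mulA -!zpow_succ.
  by rewrite Z.add_pred_l !Z.succ_pred IH.
Qed.

Lemma zpow_opp a : zpow (- a) = inv (zpow a).
Proof. by apply: inv_unique; rewrite -zpow_add Z.add_opp_diag_r. Qed.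

Lemma zpow_sub a b : zpow (b - a) = inv (zpow a) ** zpow b.
Proof. by rewrite -zpow_opp -zpow_add; congr zpow; lia. Qed.

Lemma len_zpow z : len (zpow z) <= Z.abs_nat z * len h.
Proof.
have pos n : len (zpow (Z.of_nat n)) <= n * len h.
  elim: n => [|n IH]; first by rewrite zpow0 len_one.
  rewrite Nat2Z.inj_succ zpow_succ mulSn.
  by apply: leq_trans (len_mul _ _) _; rewrite leq_add2l.
case: (Z.leb_spec 0 z) => z0.
  by have := pos (Z.to_nat z); rewrite (_ : Z.of_nat _ = z); [congr (_ <= _ * _)|]; lia.
have := pos (Z.to_nat (- z)).
by rewrite (_ : Z.of_nat _ = - z)%Z ?zpow_opp ?len_inv; [congr (_ <= _ * _)|]; lia.
Qed.

Variable M : nat.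
Hypothesis near : forall g, exists k, len (inv (zpow k) ** g) <= M.

(** The two equations place [a] and [u] on geodesics from [one] to the equal or adjacent points [p]
    and [q]. *)
Definition fellow_travel K := forall a u p q,
  len a + len (inv a ** p) = len p -> len u + len (inv u ** q) = len q ->
  len (inv p ** q) <= 1 -> len a <= len u + 1 -> len u <= len a + 1 ->
  len (inv a ** u) <= K.

(** Exponents can be reduced modulo [k], so the group is finite and [K] bounds the length of all its
    elements. *)
Lemma fellow_travel_torsion k : k <> 0%Z -> zpow k = one ->
  exists K, fellow_travel K.
Proof.
move=> k0 k1; exists (Z.abs_nat k * len h + M) => a u p q _ _ _ _ _.
have mult j : zpow (k * j) = one.
  elim/Z.peano_ind: j => [|j IH|j IH]; first by rewrite Z.mul_0_r.
    by rewrite Z.mul_succ_r zpow_add IH k1 mulx1.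
  apply: (@mul_inj (zpow k)); rewrite -zpow_add mulx1 k1.
  by rewrite (_ : (k + k * Z.pred j = k * j)%Z) //; lia.
have [j jP] := near (inv a ** u).
have jE : zpow j = zpow (j mod k).
  by rewrite {1}(Z.div_mod j k k0) zpow_add mult mul1.
move: jP; rewrite jE; set z := (_ mod _)%Z => jP.
have := len_tri one (zpow z) (inv a ** u); rewrite inv_one !mul1.
have := len_zpow z; have : Z.abs_nat z <= Z.abs_nat k.
  by rewrite /z; have := Z.mod_bound_or j k k0; lia.
move=> zk; have := leq_mul zk (leqnn (len h)); lia.
Qed.

Section InfiniteOrder.

Hypothesis torsion_free : forall k, zpow k = one -> k = 0%Z.

(** There are finitely many words of size at most [B], and each represents at most one power of
    [h]. *)
Lemma zpow_proper B : exists D, forall k,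
  len (zpow k) <= B -> (Z.abs k <= Z.of_nat D)%Z.
Proof.
have ex_bound (w : B.-bseq X) : exists D, forall k,
    zpow k = ev w -> (Z.abs k <= Z.of_nat D)%Z.
  case: (pselect (exists k, zpow k = ev w)) => [[k kw]|no].
    exists (Z.abs_nat k) => j; rewrite -kw => jk.
    have /torsion_free : zpow (j - k) = one by rewrite zpow_sub jk mulVx.
    lia.
  (* A default bound for words that represent no power of [h]. *)
  by exists 0 => k kw; case: no; exists k.
have [f fP] := choice ex_bound.
exists (\max_w f w) => k; have [w wk sw] := len_word (zpow k).
rewrite -sw => sB; have := fP (Bseq sB) k (esym wk).
have := leq_bigmax (F := f) (Bseq sB); lia.
Qed.

(** A discrete intermediate value argument: the exponents of powers near consecutive vertices differ
    by at most [D], so a path that starts near an exponent below [a] and ends near [m] cannot jump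
    far over [a]. *)
Lemma path_crosses D a m t' w g k :
  (forall j, len (zpow j) <= M + M + 1 -> (Z.abs j <= Z.of_nat D)%Z) ->
  len t' <= M -> (k <= a <= m)%Z -> len (inv (zpow k) ** g) <= M ->
  g ** ev w = zpow m ** t' ->
  exists u v j, [/\ w = u ++ v, (Z.abs (a - j) <= Z.of_nat D)%Z &
    len (inv (zpow j) ** (g ** ev u)) <= M].
Proof.
move=> DP t'M; elim: w g k => [|x w IH] g k kam kM e.
  exists [::], [::], k; split=> //; last by rewrite /= mulx1.
  suff : (Z.abs (m - k) <= Z.of_nat D)%Z by lia.
  apply: DP; rewrite zpow_sub; move: e; rewrite /= mulx1 => ge.
  have gm : len (inv (zpow m) ** g) <= M by rewrite ge mulA mulVx mul1.
  have := len_tri (zpow k) g (zpow m); rewrite (len_dist_sym g); lia.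
have [k1 k1M] := near (g ** lab x).
have k1k : (Z.abs (k1 - k) <= Z.of_nat D)%Z.
  apply: DP; rewrite zpow_sub.
  have := len_tri (zpow k) g (zpow k1).
  have := len_tri g (g ** lab x) (zpow k1).
  rewrite (len_dist_sym (g ** lab x)) (mulA (inv g)) mulVx mul1.
  have := len_lab x; lia.
case: (Z.leb_spec k1 a) => k1a; last first.
  exists [::], (x :: w), k; split=> //; first lia.
  by rewrite /= mulx1.
have [||u [v [j [wE ja jM]]]] := IH (g ** lab x) k1 _ k1M.
- by lia.
- by rewrite -e /= mulA.
exists (x :: u), v, j; split=> //; first by rewrite wE.
by rewrite /= (mulA g).
Qed.

Lemma len_zpow_add_nonneg : exists C, forall a b, (0 <= a)%Z -> (0 <= b)%Z ->
  len (zpow a) + len (zpow b) <= len (zpow (a + b)) + C.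
Proof.
have [D DP] := zpow_proper (M + M + 1).
(* [M] leads from the crossing vertex to its power [zpow j], and [D * len h] from there to [zpow a];
   each half of the path loses [C0]. *)
pose C0 := D * len h + M; exists (C0 + C0) => a b a0 b0.
have [w we <-] := len_word (zpow (a + b)).
have oneM : len one <= M by rewrite len_one.
have [|||u [v [j [wE ja jM]]]] := @path_crosses D a (a + b) one w one 0 DP oneM.
- by lia.
- by rewrite zpow0 mulx1 inv_one.
- by rewrite mul1 we mulx1.
rewrite mul1 in jM.
have near_a : len (inv (zpow a) ** ev u) <= C0.
  apply: leq_trans (len_tri _ (zpow j) _) (leq_add _ jM).
  rewrite -zpow_sub; apply: leq_trans (len_zpow _) _.
  by rewrite leq_mul2r; apply/orP; right; lia.
have h1 := len_tri one (ev u) (zpow a).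
have h2 := len_tri (zpow a) (ev u) (zpow (a + b)).
rewrite inv_one !mul1 (len_dist_sym _ (zpow a)) in h1.
rewrite -zpow_sub -we wE evalw_cat mulA mulVx mul1 in h2.
have e : (a + b - a = b)%Z by lia.
rewrite e in h2.
have := len_evalw u; have := len_evalw v; rewrite wE size_cat; lia.
Qed.

Lemma len_zpow_add : exists C, forall a b,
  ((0 <= a)%Z /\ (0 <= b)%Z) \/ ((a <= 0)%Z /\ (b <= 0)%Z) ->
  len (zpow a) + len (zpow b) <= len (zpow (a + b)) + C.
Proof.
have [C CP] := len_zpow_add_nonneg; exists C => a b [[a0 b0]|[a0 b0]].
  exact: CP.
have := CP (- a)%Z (- b)%Z; rewrite -Z.opp_add_distr !zpow_opp !len_inv.
by apply; lia.
Qed.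

Lemma len_dist_zpow i j a u E :
  len (inv (zpow i) ** a) <= E -> len (inv (zpow j) ** u) <= E ->
  len (inv a ** u) <= len (zpow (j - i)) + 2 * E /\
  len (zpow (j - i)) <= len (inv a ** u) + 2 * E.
Proof.
move=> iE jE; rewrite zpow_sub.
have := len_tri a (zpow i) u; have := len_tri (zpow i) (zpow j) u.
have := len_tri (zpow i) a (zpow j); have := len_tri a u (zpow j).
rewrite (len_dist_sym a (zpow i)) (len_dist_sym u (zpow j)); lia.
Qed.

Lemma fellow_travel_torsion_free : exists K, fellow_travel K.
Proof.
(* The extra unit lets the power near [p] serve for its neighbour [q] as well. *)
have [C CP] := len_zpow_add; pose E := M.+1.
exists (20 * E + 4 * C + 4) => a u p q ap uq pq au ua.
have near_len i g : len (inv (zpow i) ** g) <= E ->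
    len g <= len (zpow i) + 2 * E /\ len (zpow i) <= len g + 2 * E.
  move=> iE; have := @len_dist_zpow 0 i one g E.
  by rewrite zpow0 inv_one !mul1 len_one Z.sub_0_r => /(_ isT iE).
have [i iM] := near a; have [j jM] := near u; have [k kM] := near p.
have iE : len (inv (zpow i) ** a) <= E by apply: leq_trans iM _.
have jE : len (inv (zpow j) ** u) <= E by apply: leq_trans jM _.
have kE : len (inv (zpow k) ** p) <= E by apply: leq_trans kM _.
have kE' : len (inv (zpow k) ** q) <= E.
  have := len_tri (zpow k) p q; rewrite /E; lia.
have [a1 a2] := near_len _ _ iE; have [u1 u2] := near_len _ _ jE.
have [p1 p2] := near_len _ _ kE; have [q1 q2] := near_len _ _ kE'.
have [_ ap2] := len_dist_zpow iE kE; have [_ uq2] := len_dist_zpow jE kE'.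
have [au1 _] := len_dist_zpow iE jE.
have opp z : len (zpow (- z)) = len (zpow z) by rewrite zpow_opp len_inv.
(* This suffices once [a] or [u] is short, because their lengths differ by at most 1. *)
have au_le : len (inv a ** u) <= len a + len u.
  by apply: leq_trans (len_mul _ _) _; rewrite len_inv.
(* If the foot of a (or of u) and the foot of p lie on opposite sides of the
   identity, the geodesic through a backtracks, which forces a to be short. *)
have back x : ((x <= 0)%Z /\ (0 <= k)%Z) \/ ((0 <= x)%Z /\ (k <= 0)%Z) ->
    len (zpow x) + len (zpow k) <= len (zpow (k - x)) + C.
  move=> xk; have := CP (- x)%Z k; rewrite opp Z.add_comm; apply; lia.
(* When the feet of [a] and [u] lie on the same side, additivity bounds their distance by the
   difference of their lengths, which is bounded like that of [len a] and [len u]. *)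
have fwd x y : ((0 <= x)%Z /\ (x <= y)%Z) \/ ((x <= 0)%Z /\ (y <= x)%Z) ->
    len (zpow x) + len (zpow (y - x)) <= len (zpow y) + C.
  move=> xy; have := CP x (y - x)%Z.
  by rewrite Zplus_minus; apply; lia.
have ji : len (zpow (j - i)) = len (zpow (i - j)).
  by rewrite -opp; congr (len (zpow _)); lia.
have := back i; have := back j; have := fwd i j; have := fwd j i.
case: (Z.leb_spec 0 i) => i0; case: (Z.leb_spec 0 j) => j0;
  case: (Z.leb_spec 0 k) => k0; case: (Z.leb_spec i j) => ij; lia.
Qed.

End InfiniteOrder.

Lemma fellow_travel_ex : exists2 K, 0 < K & fellow_travel K.
Proof.
have [K KP] : exists K, fellow_travel K.
  case: (pselect (forall k, zpow k = one -> k = 0%Z)).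
    exact: fellow_travel_torsion_free.
  move=> /existsNP[k /not_implyP[k1 k0]]; exact: fellow_travel_torsion k0 k1.
by exists K.+1 => // a u p q ? ? ? ? ?; apply: leqW; apply: (KP a u p q).
Qed.

End Powers.

Lemma virtually_cyclic_fellow_travel :
  virtually_cyclic mul one inv -> exists2 K, 0 < K & fellow_travel K.
Proof.
case=> h [s sP].
have [M MP] : exists M, forall t, List.In t s -> len t <= M.
  elim: s {sP} => [|t s [M MP]]; first by exists 0.
  exists (len t + M) => t' [<-|/MP]; first exact: leq_addr.
  by move/leq_trans; apply; apply: leq_addl.
apply: (@fellow_travel_ex h M) => g.
(* Inverting turns the left coset of [inv g] into a right coset, so that [g] is a power of [h]
   followed by a short element. *)
have [t [ts [k gE]]] := sP (inv g).
have [z zE] : exists z, inv g = t ** zpow h z.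
  case: gE => ->; [exists (Z.of_nat k) | exists (- Z.of_nat k)%Z]; congr (_ ** _).
    by rewrite /zpow (_ : (0 <=? _)%Z = true) ?Nat2Z.id //; lia.
  case: k => [//|k]; rewrite /zpow (_ : (0 <=? _)%Z = false); last lia.
  by rewrite Z.opp_involutive Nat2Z.id.
exists (- z)%Z; rewrite zpow_opp inv_inv -(inv_inv g) zE inv_mul mulA mulxV mul1.
by rewrite len_inv; apply: MP.
Qed.

(** * Cone types: the words [w] that prolong the geodesics from [one] to [g] *)

Definition cone (g : G) (w : seq X) : bool := len (g ** ev w) == len g + size w.

Lemma len_mul_evalw g w : len (g ** ev w) <= len g + size w.
Proof. by apply: leq_trans (len_mul _ _) _; rewrite leq_add2l len_evalw. Qed.

Lemma cone_cat g u v : cone g (u ++ v) = cone g u && cone (g ** ev u) v.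
Proof.
rewrite /cone evalw_cat mulA size_cat.
have := len_mul_evalw g u; have := len_mul_evalw (g ** ev u) v; lia.
Qed.

Lemma cone_cons g x w : cone g (x :: w) = cone g [:: x] && cone (g ** lab x) w.
Proof. by rewrite -cat1s cone_cat evalw1. Qed.

(** The ball of radius [K] is represented by words, so these sets form a finite type and can serve
    as vertices. *)
Definition descents K (g : G) : {set K.-bseq X} :=
  [set t : K.-bseq X | len (g ** ev t) < len g].

(** The inverse of the last letter of a geodesic word for [g] is a descent; so [descents] separates
    [one] from all other elements. *)
Lemma descents_neq0 K g : 0 < K -> g <> one -> descents K g != set0.
Proof.
move=> K_gt0 g1; have [w wg wl] := len_word g.
case/lastP: w wg wl => [|w x] wg wl; first by case: g1; rewrite -wg.
have [y yx] := gen.1 x; apply/set0Pn; exists (Bseq (K_gt0 : size [:: y] <= K)).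
rewrite inE /= mulx1 yx -{1}wg -cats1 evalw_cat evalw1 mulK -wl size_rcons ltnS.
exact: len_evalw.
Qed.

Section ConeTypes.

Variable K : nat.
Hypothesis K_gt0 : 0 < K.
Hypothesis fellow : fellow_travel K.

(* If wx extends the cone of g but not that of g', a geodesic to g'wx passes
   near g' one step too early, at g't with t a descent of g'; then t is also a
   descent of g, and going through gt shortens gwx. *)
Lemma descents_sub_cone g g' w :
  descents K g = descents K g' -> cone g w -> cone g' w.
Proof.
move=> gg'; elim/last_ind: w => [|w x IH].
  by rewrite /cone /= !mulx1 !addn0 !eqxx.
move=> gwx; have gw : cone g w by move: gwx; rewrite -cats1 cone_cat => /andP[].
have {IH} /eqP g'w := IH gw; case: (pselect (g' = one)) => [g'1|g'1].
  have [g1|g1] := pselect (g = one); first by rewrite g'1 -g1.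
  have := descents_neq0 K_gt0 g1; rewrite gg' g'1 => /set0Pn[t].
  by rewrite inE len_one.
have g'_gt0 : 0 < len g' by rewrite lt0n; apply/eqP => /len_eq0.
rewrite /cone eqn_leq len_mul_evalw leqNgt; apply/negP.
set q := g' ** _ => q_lt; set p := g' ** ev w in g'w.
have pq : inv p ** q = lab x.
  by rewrite /p /q -cats1 evalw_cat evalw1 (mulA g') mulA mulVx mul1.
have p_le : len p <= len q + 1.
  have := len_tri one q p; rewrite inv_one !mul1 (len_dist_sym q) pq.
  by have := len_lab x; lia.
have [z zq zl] := len_word q.
have z_ge : (len g').-1 <= size z by rewrite zl; lia.
(* The geodesic to [q] is cut one letter below the level of [g'], so that the short element from
   [g'] to [u] is a descent of [g']. *)
pose u := ev (take (len g').-1 z); pose v := ev (drop (len g').-1 z).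
have uv : u ** v = q by rewrite -evalw_cat cat_take_drop.
have u_le : len u <= (len g').-1.
  by apply: leq_trans (len_evalw _) _; rewrite size_takel.
have v_le : len v <= len q - (len g').-1.
  by apply: leq_trans (len_evalw _) _; rewrite size_drop zl.
have q_le : len q <= len u + len v by rewrite -uv len_mul.
have uq : inv u ** q = v by rewrite -uv mulA mulVx mul1.
have g'p : inv g' ** p = ev w by rewrite /p mulA mulVx mul1.
have w_le := len_evalw w.
have p_le2 := len_mul g' (ev w).
rewrite size_rcons in q_lt.
have : len (inv g' ** u) <= K.
  apply: (@fellow g' u p q).
  - by rewrite g'p; move: g'w p_le2; rewrite -/p; lia.
  - by rewrite uq; lia.
  - by rewrite pq len_lab.
  - by lia.
  - by lia.
have [t tE <-] := len_word (inv g' ** u) => tK.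
have : Bseq tK \in descents K g'.
  by rewrite inE /= tE mulA mulxV mul1; lia.
rewrite -gg' inE /= tE => gt_lt.
have gE : g ** ev (rcons w x) = g ** (inv g' ** u) ** v.
  by rewrite -mulA -(mulA (inv g')) uv /q (mulA (inv g')) mulVx mul1.
move/eqP: gwx; rewrite gE size_rcons.
have := len_mul (g ** (inv g' ** u)) v; lia.
Qed.

Lemma descents_cone g g' w : descents K g = descents K g' -> cone g w = cone g' w.
Proof. by move=> gg'; apply/idP/idP; apply: descents_sub_cone. Qed.

End ConeTypes.

(** * Counting geodesics by cones *)

Definition cone_sphere g k := #|[set t : k.-tuple X | cone g t]|.

Definition cone_ball g n := \sum_(k < n.+1) cone_sphere g k.

Lemma cone_sphere0 g : cone_sphere g 0 = 1.
Proof.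
rewrite /cone_sphere (eq_card (_ : _ =i [set: 0.-tuple X])).
  by rewrite cardsT card_tuple.
by move=> t; rewrite !inE tuple0 /cone /= mulx1 addn0 eqxx.
Qed.

Lemma cone_sphereS g k :
  cone_sphere g k.+1 = \sum_x cone g [:: x] * cone_sphere (g ** lab x) k.
Proof.
rewrite /cone_sphere -sum1dep_card.
pose consT (p : X * k.-tuple X) : k.+1.-tuple X := [tuple of p.1 :: p.2].
pose unconsT (t : k.+1.-tuple X) := (thead t, [tuple of behead t]).
rewrite (reindex consT) /=; last first.
  exists unconsT => [[x t] _|t _]; last by rewrite /consT /= -tuple_eta.
  by rewrite /unconsT theadE; congr pair; apply: val_inj.
rewrite big_mkcond /= (eq_bigr (fun p : X * k.-tuple X => nat_of_bool (cone g [:: p.1]) *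
  nat_of_bool (cone (g ** lab p.1) p.2))); last first.
  by case=> x t _; rewrite /= cone_cons; do 2 case: (cone _ _).
rewrite -(pair_bigA _ (fun x (t : k.-tuple X) => nat_of_bool (cone g [:: x]) *
  nat_of_bool (cone (g ** lab x) t))) /=.
apply: eq_bigr => x _; rewrite -big_distrr /=; congr muln.
by rewrite -sum1dep_card [RHS]big_mkcond; apply: eq_bigr => t _; case: (cone _ _).
Qed.

Lemma cone_ball0 g : cone_ball g 0 = 1.
Proof. by rewrite /cone_ball big_ord1 cone_sphere0. Qed.

Lemma cone_ballS g n :
  cone_ball g n.+1 = 1 + \sum_x cone g [:: x] * cone_ball (g ** lab x) n.
Proof.
rewrite /cone_ball big_ord_recl cone_sphere0; congr addn.
under [RHS]eq_bigr do rewrite big_distrr.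
by rewrite exchange_big; apply: eq_bigr => k _; rewrite /= /bump add1n cone_sphereS.
Qed.

(** The extra unit in the base absorbs the empty word at each step. *)
Lemma cone_ball_le g n : cone_ball g n <= #|X|.+1 ^ n.
Proof.
elim: n g => [|n IH] g; first by rewrite cone_ball0.
rewrite cone_ballS expnS mulSn leq_add ?expn_gt0 // -sum_nat_const.
apply: leq_sum => x _; rewrite -[X in _ <= X]mul1n.
by apply: leq_mul => //; case: (cone _ _).
Qed.

Lemma geodesic_cone w : geodesic mul one lab w <-> cone one w.
Proof.
rewrite /cone mul1 len_one add0n; split=> [geo|/eqP wl w' e].
  have [w' w'w w'l] := len_word (ev w).
  by rewrite eqn_leq len_evalw -w'l geo.
by rewrite -wl -e len_evalw.
Qed.

Lemma geod_growth_cone n : geod_growth mul one lab n = cone_ball one n.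
Proof.
apply: eq_bigr => k _; apply: eq_card => t; rewrite !inE.
by apply/asboolP/idP => /geodesic_cone.
Qed.

Lemma cone_ball_dichotomy g : virtually_cyclic mul one inv ->
  (exists2 q, 0 < q & forall n, 2 ^ n <= cone_ball g n ^ (q * 2)) \/
  exists d, poly_growth d (cone_ball g).
Proof.
case/virtually_cyclic_fellow_travel => K K_gt0 fellow.
(* Sets that are not of the form [descents K b] are represented by [one]; the recurrence [PS] holds
   there too, since every edge leads to a set of that form. *)
have ex_rep (S : {set K.-bseq X}) :
    exists a, (exists b, descents K b = S) -> descents K a = S.
  have [[b bS]|no] := pselect (exists b, descents K b = S); first by exists b.
  by exists one.
have [rep repP] := choice ex_rep.
have rep_descents a : descents K (rep (descents K a)) = descents K a.
  by apply: repP; exists a.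
have same_ball a b n : descents K a = descents K b -> cone_ball a n = cone_ball b n.
  move=> ab; apply: eq_bigr => k _; apply: eq_card => t; rewrite !inE.
  exact: (descents_cone K_gt0 fellow).
pose A (S S' : {set K.-bseq X}) : nat :=
  \sum_(x | descents K (rep S ** lab x) == S') cone (rep S) [:: x].
pose P (S : {set K.-bseq X}) n := cone_ball (rep S) n.
have P0 S : P S 0 = 1 by exact: cone_ball0.
have PS S n : P S n.+1 = 1 + \sum_S' A S S' * P S' n.
  rewrite /P cone_ballS; congr addn.
  rewrite (partition_big (fun x => descents K (rep S ** lab x)) predT) //=.
  apply: eq_bigr => S' _; rewrite /A big_distrl; apply: eq_bigr => x /eqP <-.
  by congr muln; apply: same_ball; rewrite rep_descents.
have gP n : cone_ball g n = P (descents K g) n.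
  by apply: same_ball; rewrite rep_descents.
have [[q q_gt0 qP]|[d [c cP]]] := walks_dichotomy P0 PS (descents K g).
  by left; exists q => // n; rewrite gP.
by right; exists d, c => n; rewrite gP.
Qed.

End VirtuallyCyclic.

(** * Passage to real constants *)

Lemma INR_expn a n : INR (a ^ n) = (INR a ^ n)%R.
Proof. by elim: n => [|n IH] //=; rewrite expnS mult_INR IH. Qed.

Lemma INR_leq a b : a <= b -> (INR a <= INR b)%R.
Proof. by move=> ab; apply: le_INR; apply/leP. Qed.

Lemma pow_ltS x y n : (0 <= x < y -> x ^ n.+1 < y ^ n.+1)%R.
Proof.
move=> xy; elim: n => [|n IH]; first by rewrite !pow_1; lra.
rewrite -!(tech_pow_Rmult _ n.+1); apply: Rmult_le_0_lt_compat => //; try lra.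
by apply: pow_le; lra.
Qed.

Lemma exp_bounds_R (f : nat -> nat) q N :
  0 < q -> (forall n, 2 ^ n <= f n ^ q) -> (forall n, f n <= N ^ n) ->
  exists b B : R, (1 < b)%R /\ (b <= B)%R /\
    forall n, (b ^ n <= INR (f n) <= B ^ n)%R.
Proof.
move=> q_gt0 lo up; pose b := Rpower 2 (/ INR q).
have q_pos : (0 < INR q)%R by apply: lt_0_INR; apply/ltP.
have b_gt1 : (1 < b)%R.
  rewrite -(Rpower_O 2); last lra.
  by apply: Rpower_lt; [lra | apply: Rinv_0_lt_compat].
have bq : (b ^ q = 2)%R.
  rewrite -Rpower_pow; last lra.
  by rewrite Rpower_mult Rinv_l ?Rpower_1; lra.
have b_le n : (b ^ n <= INR (f n))%R.
  apply: Rnot_lt_le => f_lt.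
  have : (INR (f n) ^ q < (b ^ n) ^ q)%R.
    by rewrite -(prednK q_gt0); apply: pow_ltS; have := pos_INR (f n); lra.
  rewrite -pow_mult Nat.mul_comm pow_mult bq -INR_expn.
  have := INR_leq (lo n); rewrite INR_expn (_ : INR 2 = 2%R) //; lra.
exists b, (INR N); split=> //; split.
  (* The bounds at [n = 1] give [b <= INR N]. *)
  by have := b_le 1; have := INR_leq (up 1); rewrite expn1 /=; lra.
by move=> n; split => //; rewrite -INR_expn; apply: INR_leq.
Qed.

Lemma poly_bounds_R (f : nat -> nat) d : poly_growth d f ->
  exists (d : nat) (c1 c2 : R), (0 < c1)%R /\ (0 < c2)%R /\
    forall n : nat, (c1 * INR n.+1 ^ d <= INR (f n) <= c2 * INR n.+1 ^ d)%R.
Proof.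
case=> c cP; have c_gt0 : 0 < c.
  by have [] := cP 0; rewrite exp1n; case: c {cP} => [|c] //; rewrite mul0n.
have c_pos : (0 < INR c)%R by apply: lt_0_INR; apply/ltP.
exists d, (/ INR c)%R, (INR c); split; first exact: Rinv_0_lt_compat.
split=> // n; have [/INR_leq lo /INR_leq up] := cP n.
rewrite -INR_expn; rewrite !mult_INR in lo up; split=> //.
apply: (Rmult_le_reg_l (INR c)) => //.
by rewrite -Rmult_assoc Rinv_r ?Rmult_1_l //; lra.
Qed.

Theorem theorem1p2 (G : Type) (mul : G -> G -> G) (one : G) (inv : G -> G)
  (X : finType) (lab : X -> G) :
  is_group mul one inv ->
  virtually_cyclic mul one inv ->
  sym_gen_set mul one inv lab ->
  (exists b B : R, (1 < b)%R /\ (b <= B)%R /\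
     forall n : nat, (b ^ n <= INR (geod_growth mul one lab n) <= B ^ n)%R)
  \/
  (exists (d : nat) (c1 c2 : R), (0 < c1)%R /\ (0 < c2)%R /\
     forall n : nat,
       (c1 * INR n.+1 ^ d <= INR (geod_growth mul one lab n)
        <= c2 * INR n.+1 ^ d)%R).
Proof.
move=> grp vc gen.
have [[q q_gt0 lo]|[d [c poly]]] := cone_ball_dichotomy grp gen one vc.
  left; apply: (@exp_bounds_R _ (q * 2) #|X|.+1) => [|n|n].
  - by rewrite muln_gt0 q_gt0.
  - by rewrite (geod_growth_cone grp gen).
  - by rewrite (geod_growth_cone grp gen) cone_ball_le.
right; apply: (@poly_bounds_R _ d); exists c => n.
by rewrite (geod_growth_cone grp gen).
Qed.
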